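(* For every type $\sigma$, the system $\mathsf P$ proves $\Omega$-$\mathsf{CA}$: for every standard $F^{(\sigma\times0)\to0}$ and every $M^0\in\Omega$, if $F(\cdot,M)$ is $\Omega$-invariant, i.e. \[ (\forall^{\mathrm{st}}x^\sigma)(\forall N^0\in\Omega)\big[F(x,M)=_0F(x,N)\big], \] then there is a standard $G^{\sigma\to0}$ such that \[ (\forall^{\mathrm{st}}x^\sigma)(\forall N^0\in\Omega)\big[G(x)=_0F(x,N)\big]. \]
   Context: Framework. $\mathsf{E\text{-}PA}^{\omega*}$ is Peano arithmetic in all finite types with the axiom of extensionality, with additional types $\rho^*$ of finite sequences; type $0$ = naturals. The language of $\mathsf P$ adds a predicate $\mathrm{st}$ (''standard'') for every type; $(\forall^{\mathrm{st}}x)\varphi\equiv(\forall x)(\mathrm{st}(x)\to\varphi)$, $(\exists^{\mathrm{st}}x)\varphi\equiv(\exists x)(\mathrm{st}(x)\wedge\varphi)$; internal = not containing $\mathrm{st}$. $\mathsf P$ is $\mathsf{E\text{-}PA}^{\omega*}$ plus: (i) $\mathrm{st}(x)\wedge x=y\to\mathrm{st}(y)$; (ii) $\mathrm{st}(t)$ for each closed term $t$ of $\mathsf{E\text{-}PA}^{\omega*}$; (iii) $\mathrm{st}(f)\wedge\mathrm{st}(x)\to\mathrm{st}(f(x))$; (iv) external induction $[\Phi(0)\wedge(\forall^{\mathrm{st}}n^0)(\Phi(n)\to\Phi(n+1))]\to(\forall^{\mathrm{st}}m^0)\Phi(m)$ for every formula $\Phi$; (v) $\mathsf{HAC}_{\mathrm{int}}$: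 for internal $\varphi$, $(\forall^{\mathrm{st}}x^\rho)(\exists^{\mathrm{st}}y^\tau)\varphi(x,y)\to(\exists^{\mathrm{st}}F^{\rho\to\tau^*})(\forall^{\mathrm{st}}x^\rho)(\exists y\in F(x))\varphi(x,y)$; (vi) idealisation: for internal $\varphi$ with arbitrary parameters, $(\forall^{\mathrm{st}}x^{\sigma^*})(\exists y^\tau)(\forall z^\sigma\in x)\varphi(z,y)\to(\exists y^\tau)(\forall^{\mathrm{st}}x^\sigma)\varphi(x,y)$. $N^0\in\Omega$ means $\neg\mathrm{st}(N)$ ($N$ is infinite), and $(\forall N\in\Omega)$ ranges over such $N$. *)

(* Defs.v *)
(* A deep embedding of the system P over E-PA^{omega*}. *)
From Stdlib Require Import List.
Import ListNotations.

Set Implicit Arguments.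

(* There are no product types: a functional of type (s x t) -> r is, as usual
   in this setting, the curried one of type s -> (t -> r), and F(x, y) is
   F x y. *)
Inductive ty : Type :=
| Nat : ty
| Arr : ty -> ty -> ty
| Seq : ty -> ty.

Declare Scope ty_scope.
Delimit Scope ty_scope with ty.
Bind Scope ty_scope with ty.
Notation "s '==>' t" := (Arr s t) (at level 55, right associativity) : ty_scope.

Definition ctx := list ty.

(* Well-typed de Bruijn variables; position 0 is the innermost binder. *)
Inductive var : ctx -> ty -> Type :=
| VZ : forall G s, var (s :: G) s
| VS : forall G s t, var G t -> var (s :: G) t.
Arguments VZ {G s}.
Arguments VS {G s t} _.

Inductive const : ty -> Type :=
| CZero : const Nat
| CSucc : const (Nat ==> Nat)
| CPi (s t : ty) : const (s ==> t ==> s)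
| CSigma (r s t : ty) : const ((r ==> s ==> t) ==> (r ==> s) ==> r ==> t)
| CRec (r : ty) : const (Nat ==> r ==> (r ==> Nat ==> r) ==> r)
| CNil (s : ty) : const (Seq s)
| CCons (s : ty) : const (s ==> Seq s ==> Seq s)
| CLrec (s r : ty) : const (Seq s ==> r ==> (r ==> s ==> Seq s ==> r) ==> r).

Inductive tm (G : ctx) : ty -> Type :=
| TVar : forall t, var G t -> tm G t
| TConst : forall t, const t -> tm G t
| TApp : forall s t, tm G (s ==> t) -> tm G s -> tm G t.
Arguments TVar {G t} _.
Arguments TConst {G t} _.
Arguments TApp {G s t} _ _.

Declare Scope tm_scope.
Delimit Scope tm_scope with tm.
Bind Scope tm_scope with tm.
Notation "t @ u" := (TApp t u) (at level 40, left associativity) : tm_scope.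
Local Open Scope tm_scope.

Definition tzero {G} : tm G Nat := TConst CZero.
Definition tsucc {G} (t : tm G Nat) : tm G Nat := TConst CSucc @ t.
Definition tpi {G} s t : tm G (s ==> t ==> s) := TConst (CPi s t).
Definition tsigma {G} r s t : tm G ((r ==> s ==> t) ==> (r ==> s) ==> r ==> t) :=
  TConst (CSigma r s t).
Definition tnil {G} s : tm G (Seq s) := TConst (CNil s).
Definition tcons {G s} (a : tm G s) (x : tm G (Seq s)) : tm G (Seq s) :=
  TConst (CCons s) @ a @ x.
Definition trec {G r} (n : tm G Nat) (y : tm G r) (z : tm G (r ==> Nat ==> r)) :
  tm G r := TConst (CRec r) @ n @ y @ z.
Definition tlrec {G s r} (x : tm G (Seq s)) (y : tm G r)
  (z : tm G (r ==> s ==> Seq s ==> r)) : tm G r :=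
  TConst (CLrec s r) @ x @ y @ z.

Definition v0 {G a} : tm (a :: G) a := TVar VZ.
Definition v1 {G a b} : tm (a :: b :: G) b := TVar (VS VZ).
Definition v2 {G a b c} : tm (a :: b :: c :: G) c := TVar (VS (VS VZ)).
Definition v4 {G a b c d e} : tm (a :: b :: c :: d :: e :: G) e :=
  TVar (VS (VS (VS (VS VZ)))).
Definition v5 {G a b c d e f} : tm (a :: b :: c :: d :: e :: f :: G) f :=
  TVar (VS (VS (VS (VS (VS VZ))))).

(* The assignment on s :: G that sends variable 0 to a and the others by f. *)
Definition scons {P : ty -> Type} {G s} (a : P s) (f : forall t, var G t -> P t)
  t (x : var (s :: G) t) : P t :=
  match x in var G' t' return
    match G' with
    | [] => unit
    | s' :: G'' => P s' -> (forall u, var G'' u -> P u) -> P t'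
    end
  with
  | VZ => fun a _ => a
  | VS y => fun _ f => f _ y
  end a f.

Definition sub (G D : ctx) := forall t, var G t -> tm D t.

Fixpoint tsubst {G D} (f : sub G D) {t} (u : tm G t) : tm D t :=
  match u with
  | TVar x => f _ x
  | TConst c => TConst c
  | TApp u1 u2 => tsubst f u1 @ tsubst f u2
  end.

Definition shift {G s} : sub G (s :: G) := fun t x => TVar (VS x).
Definition up {G D} s (f : sub G D) : sub (s :: G) (s :: D) :=
  scons (P := tm (s :: D)) v0 (fun t x => tsubst shift (f t x)).
Definition inst {G s} (a : tm G s) : sub (s :: G) G :=
  scons (P := tm G) a (fun t x => TVar x).
Definition inst_succ {G} : sub (Nat :: G) (Nat :: G) :=
  scons (P := tm (Nat :: G)) (tsucc v0) shift.
Definition sub_nil {G} : sub [] G := fun t x =>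
  match x in var G' t' return match G' with [] => tm G t' | _ => unit end with
  | VZ => tt
  | VS _ => tt
  end.

Definition twk {G s t} (u : tm G t) : tm (s :: G) t := tsubst shift u.

(* Bracket abstraction: lambda is not primitive, only the combinators are. *)
Fixpoint lam {G s t} (u : tm (s :: G) t) : tm G (s ==> t) :=
  match u in tm _ t' return tm G (s ==> t') with
  | TVar x =>
      scons (P := fun t' => tm G (s ==> t'))
        (tsigma s (s ==> s) s @ tpi s (s ==> s) @ tpi s s)
        (fun t' y => tpi t' s @ TVar y) x
  | TConst c => tpi _ s @ TConst c
  | TApp u1 u2 => tsigma _ _ _ @ lam u1 @ lam u2
  end.

Definition tplus {G} (m n : tm G Nat) : tm G Nat :=
  trec n m (lam (lam (tsucc v1))).

Fixpoint tdefault {G} (s : ty) : tm G s :=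
  match s with
  | Nat => tzero
  | Arr a b => tpi b a @ tdefault b
  | Seq a => tnil a
  end.

(* |x| *)
Definition tlen {G s} (x : tm G (Seq s)) : tm G Nat :=
  tlrec x tzero (lam (lam (lam (tsucc v2)))).

(* (x)_i, with <>_i the default object, (C a x)_0 = a and
   (C a x)_{i+1} = (x)_i; in the step, the variables are, from the outside,
   the function i |-> (x)_i, then a, x, i. *)
Definition tnth {G s} (x : tm G (Seq s)) (i : tm G Nat) : tm G s :=
  tlrec x (tdefault (Nat ==> s))
    (lam (lam (lam (lam (trec v0 v2 (lam (lam (v5 @ v0)))))))) @ i.

Inductive fm (G : ctx) : Type :=
| FEq : forall t, tm G t -> tm G t -> fm G
| FSt : forall t, tm G t -> fm G
| FBot : fm G
| FImp : fm G -> fm G -> fm G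
| FAnd : fm G -> fm G -> fm G
| FOr : fm G -> fm G -> fm G
| FAll : forall s, fm (s :: G) -> fm G
| FEx : forall s, fm (s :: G) -> fm G.
Arguments FEq {G t} _ _.
Arguments FSt {G t} _.
Arguments FBot {G}.
Arguments FImp {G} _ _.
Arguments FAnd {G} _ _.
Arguments FOr {G} _ _.
Arguments FAll {G} s _.
Arguments FEx {G} s _.

Declare Scope fm_scope.
Delimit Scope fm_scope with fm.
Bind Scope fm_scope with fm.
Notation "t '==' u" := (FEq t%tm u%tm) (at level 70, no associativity) : fm_scope.
Notation "A '/.\' B" := (FAnd A B) (at level 80, right associativity) : fm_scope.
Notation "A '\./' B" := (FOr A B) (at level 85, right associativity) : fm_scope.
Notation "A '-.>' B" := (FImp A B) (at level 90, right associativity) : fm_scope.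
Notation "'\neg' A" := (FImp A FBot) (at level 75, right associativity) : fm_scope.
Local Open Scope fm_scope.

Fixpoint fsubst {G D} (f : sub G D) (A : fm G) : fm D :=
  match A with
  | FEq t u => tsubst f t == tsubst f u
  | FSt t => FSt (tsubst f t)
  | FBot => FBot
  | FImp A B => fsubst f A -.> fsubst f B
  | FAnd A B => fsubst f A /.\ fsubst f B
  | FOr A B => fsubst f A \./ fsubst f B
  | FAll s A => FAll s (fsubst (up f) A)
  | FEx s A => FEx s (fsubst (up f) A)
  end.

Definition fwk {G s} (A : fm G) : fm (s :: G) := fsubst shift A.

Fixpoint internal {G} (A : fm G) : Prop :=
  match A with
  | FEq _ _ => True
  | FSt _ => False
  | FBot => True
  | FImp A B | FAnd A B | FOr A B => internal A /\ internal B
  | FAll _ A | FEx _ A => internal A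
  end.

Definition FAllSt {G} s (A : fm (s :: G)) : fm G := FAll s (FSt v0 -.> A).
Definition FExSt {G} s (A : fm (s :: G)) : fm G := FEx s (FSt v0 /.\ A).

Definition FInf {G} (n : tm G Nat) : fm G := \neg FSt n.
Definition FAllInf {G} (A : fm (Nat :: G)) : fm G := FAll Nat (FInf v0 -.> A).

Definition FLt {G} (m n : tm G Nat) : fm G :=
  FEx Nat (tplus (twk m) (tsucc v0) == twk n).
Definition FIn {G s} (a : tm G s) (x : tm G (Seq s)) : fm G :=
  FEx Nat (FLt v0 (tlen (twk x)) /.\ (twk a == tnth (twk x) v0)).

(* Axioms may contain free variables from the context G (the parameters).
   Equality is primitive at every type.  Leibniz's law and induction are schemes
   of E-PA^{omega*}, hence restricted to internal formulas; the replacement of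
   equals under st is the separate axiom ax_st_eq.  The scheme ax_leibniz
   includes x = y -> f x = f y, and ax_ext adds that pointwise equal functionals
   are equal. *)

Inductive EPA_ax {G : ctx} : fm G -> Prop :=
| ax_refl : forall s (t : tm G s), EPA_ax (t == t)
| ax_leibniz : forall s (t u : tm G s) (A : fm (s :: G)), internal A ->
    EPA_ax (t == u -.> fsubst (inst t) A -.> fsubst (inst u) A)
| ax_ext : forall s t (f g : tm G (s ==> t)),
    EPA_ax (FAll s (twk f @ v0 == twk g @ v0) -.> f == g)
| ax_succ_neq0 : forall n : tm G Nat, EPA_ax (\neg (tsucc n == tzero))
| ax_succ_inj : forall m n : tm G Nat, EPA_ax (tsucc m == tsucc n -.> m == n)
| ax_ind : forall A : fm (Nat :: G), internal A ->
    EPA_ax (fsubst (inst tzero) A -.> FAll Nat (A -.> fsubst inst_succ A) -.>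
            FAll Nat A)
| ax_pi : forall s t (x : tm G s) (y : tm G t), EPA_ax (tpi s t @ x @ y == x)
| ax_sigma : forall r s t (x : tm G (r ==> s ==> t)) (y : tm G (r ==> s))
    (z : tm G r), EPA_ax (tsigma r s t @ x @ y @ z == x @ z @ (y @ z))
| ax_rec0 : forall r (y : tm G r) z, EPA_ax (trec tzero y z == y)
| ax_recS : forall r n (y : tm G r) z,
    EPA_ax (trec (tsucc n) y z == z @ trec n y z @ n)
| ax_lrec_nil : forall s r (y : tm G r) z, EPA_ax (tlrec (tnil s) y z == y)
| ax_lrec_cons : forall s r (a : tm G s) x (y : tm G r) z,
    EPA_ax (tlrec (tcons a x) y z == z @ tlrec x y z @ a @ x)
| ax_seq : forall s (x : tm G (Seq s)),
    EPA_ax (x == tnil s \./ FEx s (FEx (Seq s) (twk (twk x) == tcons v1 v0))).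

Inductive P_ax {G : ctx} : fm G -> Prop :=
| ax_EPA : forall A, EPA_ax A -> P_ax A
| ax_st_eq : forall s (x y : tm G s), P_ax (FSt x /.\ x == y -.> FSt y)
| ax_st_closed : forall s (t : tm [] s), P_ax (FSt (tsubst sub_nil t))
| ax_st_app : forall s t (f : tm G (s ==> t)) (x : tm G s),
    P_ax (FSt f /.\ FSt x -.> FSt (f @ x))
| ax_ext_ind : forall A : fm (Nat :: G),
    P_ax (fsubst (inst tzero) A /.\ FAllSt (A -.> fsubst inst_succ A) -.>
          FAllSt A)
(* HAC_int: in A, variable 1 is x and variable 0 is y; the substitution
   makes room for the bound variable F below them. *)
| ax_HAC : forall r t (A : fm (t :: r :: G)), internal A ->
    P_ax (FAllSt (FExSt A) -.>
          FExSt (s := r ==> Seq t) (FAllSt (s := r) (FEx t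
            (FIn v0 (v2 @ v1) /.\ fsubst (up (up shift)) A))))
(* Idealisation: in A, variable 0 is z and variable 1 is y. *)
| ax_ideal : forall s t (A : fm (s :: t :: G)), internal A ->
    P_ax (FAllSt (s := Seq s) (FEx t (FAll s
            (FIn v0 v2 -.> fsubst (up (up shift)) A))) -.>
          FEx t (FAllSt A)).

Inductive prv (Ax : forall G, fm G -> Prop) (G : ctx) (H : list (fm G)) :
  fm G -> Prop :=
| prv_ax : forall A, Ax G A -> prv Ax H A
| prv_hyp : forall A, In A H -> prv Ax H A
| prv_impI : forall A B, prv Ax (A :: H) B -> prv Ax H (A -.> B)
| prv_impE : forall A B, prv Ax H (A -.> B) -> prv Ax H A -> prv Ax H B
| prv_andI : forall A B, prv Ax H A -> prv Ax H B -> prv Ax H (A /.\ B)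
| prv_andE1 : forall A B, prv Ax H (A /.\ B) -> prv Ax H A
| prv_andE2 : forall A B, prv Ax H (A /.\ B) -> prv Ax H B
| prv_orI1 : forall A B, prv Ax H A -> prv Ax H (A \./ B)
| prv_orI2 : forall A B, prv Ax H B -> prv Ax H (A \./ B)
| prv_orE : forall A B C, prv Ax H (A \./ B) -> prv Ax (A :: H) C ->
    prv Ax (B :: H) C -> prv Ax H C
| prv_raa : forall A, prv Ax ((\neg A) :: H) FBot -> prv Ax H A
| prv_allI : forall s A, prv Ax (map (@fwk G s) H) A -> prv Ax H (FAll s A)
| prv_allE : forall s A (t : tm G s), prv Ax H (FAll s A) ->
    prv Ax H (fsubst (inst t) A)
| prv_exI : forall s A (t : tm G s), prv Ax H (fsubst (inst t) A) ->
    prv Ax H (FEx s A)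
| prv_exE : forall s A C, prv Ax H (FEx s A) ->
    prv Ax (A :: map (@fwk G s) H) (fwk C) -> prv Ax H C.

Definition P_proves (A : fm []) : Prop := prv (@P_ax) [] A.

Definition Omega_invariant {G s} (F : tm G (s ==> Nat ==> Nat)) (M : tm G Nat) :
  fm G :=
  FAllSt (s := s) (FAllInf (twk (twk F) @ v1 @ twk (twk M) ==
                            twk (twk F) @ v1 @ v0)).

(* In the last formula the variables are, from the outside, F, M, G, x, N. *)
Definition Omega_CA (s : ty) : fm [] :=
  FAllSt (s := s ==> Nat ==> Nat) (FAllInf
    (Omega_invariant v1 v0 -.>
     FExSt (s := s ==> Nat) (FAllSt (s := s) (FAllInf
       (v2 @ v1 == v4 @ v1 @ v0))))).

(* Main.v *)
(** Call [k] a modulus at [x] if [F(x, n) = F(x, k)] for all [n >= k].  For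
    standard [x], Omega-invariance makes every infinite [k] a modulus at [x],
    so underspill yields a standard one.  HAC_int provides a standard [f] such
    that the finite sequence [f(x)] contains a modulus at [x].  The sum of the
    entries of [f(x)] lies above that modulus and, being standard, below every
    infinite [N]; hence [G(x) := F(x, sum f(x))] equals [F(x, N)]. *)
From Stdlib Require Import List Morphisms.
Import ListNotations.
Require Import Defs.

Set Implicit Arguments.
Local Open Scope tm_scope.
Local Open Scope fm_scope.

(** * Substitution *)

Lemma var_cons_ind G s (P : forall t, var (s :: G) t -> Prop) :
  P s VZ -> (forall t y, P t (VS y)) -> forall t x, P t x.
Proof.
  intros HZ HS t x; revert P HZ HS.
  refine (match x as x' in var G' t' return
    match G' as G'' return var G'' t' -> Prop with
    | [] => fun _ => True
    | s' :: G'' => fun x' => forall P : forall t, var (s' :: G'') t -> Prop,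
        P s' VZ -> (forall t y, P t (VS y)) -> P t' x'
    end x' with VZ => _ | VS y => _ end); auto.
Qed.

Lemma var_nil_ind (P : forall t, var [] t -> Prop) t x : P t x.
Proof.
  refine (match x as x' in var G' t' return
    match G' as G'' return var G'' t' -> Prop with
    | [] => fun x' => P t' x'
    | _ :: _ => fun _ => True
    end x' with VZ => I | VS _ => I end).
Qed.

Lemma tsubst_ext G D (f g : sub G D) t (u : tm G t) :
  (forall t x, f t x = g t x) -> tsubst f u = tsubst g u.
Proof. intros fg; induction u; cbn; congruence. Qed.

Lemma tsubst_comp G D K (f : sub G D) (g : sub D K) t (u : tm G t) :
  tsubst g (tsubst f u) = tsubst (fun t x => tsubst g (f t x)) u.
Proof. induction u; cbn; congruence. Qed.

Lemma tsubst_id G t (u : tm G t) : tsubst (fun t x => TVar x) u = u.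
Proof. induction u; cbn; congruence. Qed.

Lemma tsubst_scons_shift G D s t (a : tm D s) (f : sub G D) (u : tm G t) :
  tsubst (scons (P := tm D) a f) (tsubst shift u) = tsubst f u.
Proof. rewrite tsubst_comp; apply tsubst_ext; reflexivity. Qed.

Lemma tsubst_inst_shift G s t (a : tm G s) (u : tm G t) :
  tsubst (inst a) (tsubst shift u) = u.
Proof. unfold inst; rewrite tsubst_scons_shift; apply tsubst_id. Qed.

Lemma tsubst_inst_succ_shift G t (u : tm G t) :
  tsubst inst_succ (tsubst shift u) = tsubst shift u.
Proof. apply tsubst_scons_shift. Qed.

Lemma tsubst_up_shift G D s t (f : sub G D) (u : tm G t) :
  tsubst (up f) (tsubst (shift (s := s)) u) = tsubst shift (tsubst f u).
Proof. unfold up; rewrite tsubst_scons_shift, tsubst_comp; reflexivity. Qed.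

Lemma up_ext G D s (f g : sub G D) : (forall t x, f t x = g t x) ->
  forall t (x : var (s :: G) t), up f x = up g x.
Proof.
  intros fg; apply var_cons_ind; [reflexivity |].
  intros t y; exact (f_equal (tsubst shift) (fg t y)).
Qed.

Lemma up_comp G D K s (f : sub G D) (g : sub D K) t (x : var (s :: G) t) :
  tsubst (up g) (up f x) = up (fun t x => tsubst g (f t x)) x.
Proof.
  revert t x; apply var_cons_ind; [reflexivity | intros; apply tsubst_up_shift].
Qed.

Lemma fsubst_ext G (A : fm G) : forall D (f g : sub G D),
  (forall t x, f t x = g t x) -> fsubst f A = fsubst g A.
Proof.
  induction A; intros D f g fg; cbn [fsubst]; f_equal;
    auto using tsubst_ext, up_ext.
Qed.

Lemma fsubst_comp G (A : fm G) : forall D K (f : sub G D) (g : sub D K),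
  fsubst g (fsubst f A) = fsubst (fun t x => tsubst g (f t x)) A.
Proof.
  induction A; intros D K f g; cbn [fsubst]; f_equal; auto using tsubst_comp;
    rewrite IHA; apply fsubst_ext; intros; apply up_comp.
Qed.

Lemma fsubst_id G (A : fm G) : fsubst (fun t x => TVar x) A = A.
Proof.
  induction A; cbn [fsubst]; f_equal; auto using tsubst_id;
    rewrite <- IHA at 2; apply fsubst_ext; apply var_cons_ind; reflexivity.
Qed.

Lemma fsubst_inst G D (f : sub G D) s (a : tm G s) A :
  fsubst f (fsubst (inst a) A) = fsubst (inst (tsubst f a)) (fsubst (up f) A).
Proof.
  rewrite !fsubst_comp; apply fsubst_ext, var_cons_ind; [reflexivity |].
  intros t y; symmetry; apply tsubst_inst_shift.
Qed.

Lemma fsubst_inst_succ G D (f : sub G D) A :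
  fsubst (up f) (fsubst inst_succ A) = fsubst inst_succ (fsubst (up f) A).
Proof.
  rewrite !fsubst_comp; apply fsubst_ext, var_cons_ind; [reflexivity |].
  intros t y; symmetry; apply tsubst_inst_succ_shift.
Qed.

Lemma fsubst_up_fwk G D (f : sub G D) s (A : fm G) :
  fsubst (up f) (fwk (s := s) A) = fwk (fsubst f A).
Proof. unfold fwk; rewrite !fsubst_comp; apply fsubst_ext; reflexivity. Qed.

Lemma map_fsubst_up_fwk G D (f : sub G D) s (H : list (fm G)) :
  map (fsubst (up f)) (map (@fwk G s) H) = map (@fwk D s) (map (fsubst f) H).
Proof. rewrite !map_map; apply map_ext; intros; apply fsubst_up_fwk. Qed.

Lemma fsubst_up_up_shift G D (f : sub G D) r s t (A : fm (s :: t :: G)) :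
  fsubst (up (up (up f))) (fsubst (up (up (shift (s := r)))) A) =
  fsubst (up (up shift)) (fsubst (up (up f)) A).
Proof.
  rewrite !fsubst_comp; apply fsubst_ext; intros; rewrite !up_comp.
  apply up_ext; intros; rewrite !up_comp; apply up_ext; reflexivity.
Qed.

Lemma fsubst_inst_v0_up_shift G s (A : fm (s :: G)) :
  fsubst (inst (TVar VZ)) (fsubst (up shift) A) = A.
Proof.
  rewrite <- fsubst_id, fsubst_comp.
  apply fsubst_ext, var_cons_ind; reflexivity.
Qed.

Lemma fsubst_inst_succ_v0_up_shift G (A : fm (Nat :: G)) :
  fsubst (inst (tsucc (TVar VZ))) (fsubst (up shift) A) = fsubst inst_succ A.
Proof.
  rewrite fsubst_comp; apply fsubst_ext, var_cons_ind; reflexivity.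
Qed.

Lemma internal_fsubst G (A : fm G) : forall D (f : sub G D),
  internal A -> internal (fsubst f A).
Proof. induction A; cbn; intuition. Qed.

Definition tclosed {G t} (u : tm [] t) : tm G t := tsubst sub_nil u.

Lemma tsubst_tclosed G D (f : sub G D) t (u : tm [] t) :
  tsubst f (tclosed u) = tclosed u.
Proof.
  unfold tclosed; rewrite tsubst_comp; apply tsubst_ext.
  intros r x; pattern r, x; apply var_nil_ind.
Qed.

Lemma tsubst_tsucc G D (f : sub G D) a :
  tsubst f (tsucc a) = tsucc (tsubst f a).
Proof. reflexivity. Qed.

Lemma tsubst_tplus G D (f : sub G D) a b :
  tsubst f (tplus a b) = tplus (tsubst f a) (tsubst f b).
Proof. reflexivity. Qed.

Lemma tsubst_tlen G D (f : sub G D) s (x : tm G (Seq s)) :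
  tsubst f (tlen x) = tlen (tsubst f x).
Proof. reflexivity. Qed.

Lemma tsubst_tdefault G D (f : sub G D) s : tsubst f (tdefault s) = tdefault s.
Proof. induction s; cbn; [reflexivity | now rewrite IHs2 | reflexivity]. Qed.

Lemma tsubst_tnth G D (f : sub G D) s (x : tm G (Seq s)) i :
  tsubst f (tnth x i) = tnth (tsubst f x) (tsubst f i).
Proof.
  unfold tnth, tlrec; cbn [tsubst]; rewrite tsubst_tdefault; reflexivity.
Qed.

#[local] Hint Rewrite tsubst_inst_shift tsubst_inst_succ_shift tsubst_up_shift
  tsubst_tclosed tsubst_tsucc tsubst_tplus tsubst_tlen tsubst_tnth
  fsubst_inst_v0_up_shift fsubst_inst_succ_v0_up_shift : subst.

Ltac simpl_subst :=
  unfold fwk, twk;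
  repeat progress
    (cbn [fsubst tsubst inst inst_succ shift up scons v0 v1 v2];
     autorewrite with subst).
Ltac simpl_subst_in p :=
  unfold fwk, twk in p;
  repeat progress
    (cbn [fsubst tsubst inst inst_succ shift up scons v0 v1 v2] in p;
     autorewrite with subst in p).

Lemma fsubst_FIn G D (f : sub G D) s (a : tm G s) x :
  fsubst f (FIn a x) = FIn (tsubst f a) (tsubst f x).
Proof. unfold FIn, FLt; simpl_subst; reflexivity. Qed.

#[local] Hint Rewrite fsubst_FIn : subst.

Lemma EPA_ax_fsubst G D (f : sub G D) A : EPA_ax A -> EPA_ax (fsubst f A).
Proof.
  intros []; cbn [fsubst]; rewrite ?fsubst_inst, ?fsubst_inst_succ.
  - apply ax_refl.
  - now apply ax_leibniz, internal_fsubst.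
  - unfold twk; cbn [tsubst]; rewrite !tsubst_up_shift; apply ax_ext.
  - apply ax_succ_neq0.
  - apply ax_succ_inj.
  - now apply ax_ind, internal_fsubst.
  - apply ax_pi.
  - apply ax_sigma.
  - apply ax_rec0.
  - apply ax_recS.
  - apply ax_lrec_nil.
  - apply ax_lrec_cons.
  - unfold twk; rewrite !tsubst_up_shift; apply ax_seq.
Qed.

Lemma P_ax_fsubst G D (f : sub G D) A : P_ax A -> P_ax (fsubst f A).
Proof.
  intros []; cbn [fsubst].
  - now apply ax_EPA, EPA_ax_fsubst.
  - apply ax_st_eq.
  - change (P_ax (FSt (tsubst f (tclosed t)))).
    rewrite tsubst_tclosed; apply ax_st_closed.
  - apply ax_st_app.
  - unfold FAllSt; cbn [fsubst]; rewrite fsubst_inst, fsubst_inst_succ.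
    apply ax_ext_ind.
  - unfold FAllSt, FExSt; cbn [fsubst].
    rewrite fsubst_FIn, fsubst_up_up_shift.
    now apply ax_HAC, internal_fsubst.
  - unfold FAllSt, FExSt; cbn [fsubst].
    rewrite fsubst_FIn, fsubst_up_up_shift.
    now apply ax_ideal, internal_fsubst.
Qed.

(** * Natural deduction *)

Lemma incl_map_cons T U (g : T -> U) a l m :
  incl (map g l) m -> incl (map g (a :: l)) (g a :: m).
Proof. exact (incl_app_app (incl_refl [g a])). Qed.

Section Theory.

Variable Ax : forall G, fm G -> Prop.
Hypothesis Ax_fsubst : forall G D (f : sub G D) A, Ax A -> Ax (fsubst f A).
Local Notation "H |-- A" := (prv (@Ax) H A%fm) (at level 95, no associativity).

Lemma prv_subst G (H : list (fm G)) A : H |-- A ->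
  forall D (f : sub G D) K, incl (map (fsubst f) H) K -> K |-- fsubst f A.
Proof.
  intros p; induction p; intros D f K HK; cbn [fsubst].
  - now apply prv_ax, Ax_fsubst.
  - now apply prv_hyp, HK, (in_map (fsubst f)).
  - apply prv_impI, IHp, incl_map_cons, HK.
  - eapply prv_impE; [now apply IHp1 | now apply IHp2].
  - apply prv_andI; auto.
  - eapply prv_andE1, IHp, HK.
  - eapply prv_andE2, IHp, HK.
  - apply prv_orI1; auto.
  - apply prv_orI2; auto.
  - eapply prv_orE; [exact (IHp1 _ f K HK) | apply IHp2 | apply IHp3];
      apply incl_map_cons, HK.
  - apply prv_raa, (IHp _ f), incl_map_cons, HK.
  - apply prv_allI, (IHp _ (up f)).
    rewrite map_fsubst_up_fwk; now apply incl_map.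
  - rewrite fsubst_inst; apply prv_allE, (IHp _ f K HK).
  - apply prv_exI with (tsubst f t); rewrite <- fsubst_inst; apply IHp, HK.
  - eapply prv_exE; [exact (IHp1 _ f K HK) |].
    rewrite <- fsubst_up_fwk.
    apply (IHp2 _ (up f)), incl_map_cons.
    rewrite map_fsubst_up_fwk; now apply incl_map.
Qed.

Lemma prv_weaken G (H K : list (fm G)) A : incl H K -> H |-- A -> K |-- A.
Proof.
  intros HK p; rewrite <- fsubst_id; apply (prv_subst p).
  now rewrite (map_ext _ _ (@fsubst_id G)), map_id.
Qed.

Lemma prv_lift G s (H : list (fm G)) K A :
  incl (map (@fwk G s) H) K -> H |-- A -> K |-- fwk A.
Proof. intros HK p; exact (prv_subst p shift HK). Qed.

(* In the following rules [K] is an arbitrary extension of [H]: a derivation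
   never has to look into its list of hypotheses, because everything known over
   [H] remains available over [K] by [prv_weaken] and [prv_lift]. *)
Lemma prv_imp_intro G (H : list (fm G)) A B :
  (forall K, incl H K -> K |-- A -> K |-- B) -> H |-- A -.> B.
Proof.
  intros p; apply prv_impI, p; [apply incl_tl, incl_refl |].
  apply prv_hyp; now left.
Qed.

Lemma prv_all_intro G (H : list (fm G)) s A :
  (forall K, incl (map (@fwk G s) H) K -> K |-- A) -> H |-- FAll s A.
Proof. intros p; apply prv_allI, p, incl_refl. Qed.

Lemma prv_or_elim G (H : list (fm G)) A B {C} : H |-- A \./ B ->
  (forall K, incl H K -> K |-- A -> K |-- C) ->
  (forall K, incl H K -> K |-- B -> K |-- C) -> H |-- C.
Proof.
  intros p a b; eapply prv_orE; [exact p | apply a | apply b];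
    first [apply incl_tl, incl_refl | apply prv_hyp; now left].
Qed.

Lemma prv_ex_elim G (H : list (fm G)) s A {C} : H |-- FEx s A ->
  (forall K, incl (map (@fwk G s) H) K -> K |-- A -> K |-- fwk C) -> H |-- C.
Proof.
  intros p c; eapply prv_exE; [exact p | apply c].
  - apply incl_tl, incl_refl.
  - apply prv_hyp; now left.
Qed.

Lemma prv_by_contradiction G (H : list (fm G)) A :
  (forall K, incl H K -> K |-- \neg A -> K |-- FBot) -> H |-- A.
Proof.
  intros p; apply prv_raa, p; [apply incl_tl, incl_refl |].
  apply prv_hyp; now left.
Qed.

Lemma prv_bot_elim G (H : list (fm G)) {C} : H |-- FBot -> H |-- C.
Proof.
  intros p; apply prv_by_contradiction; intros K HK _; exact (prv_weaken HK p).
Qed.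

Lemma prv_absurd G (H : list (fm G)) A {C} : H |-- \neg A -> H |-- A -> H |-- C.
Proof. intros p q; apply prv_bot_elim, (prv_impE p q). Qed.

Definition FLe {G} (k n : tm G Nat) : fm G :=
  FEx Nat (twk n == tplus (twk k) v0).

Lemma fsubst_FLe G D (f : sub G D) k n :
  fsubst f (FLe k n) = FLe (tsubst f k) (tsubst f n).
Proof. unfold FLe; simpl_subst; reflexivity. Qed.

Hint Rewrite fsubst_FLe : subst.

Definition teq {G} (H : list (fm G)) {t} (a b : tm G t) : Prop :=
  H |-- a == b.

Definition tle {G} (H : list (fm G)) (k n : tm G Nat) : Prop :=
  H |-- FLe k n.

Ltac fold_rel :=
  match goal with
  | |- prv _ ?H (FEq ?a ?b) => change (teq H a b)
  | |- prv _ ?H (FLe ?a ?b) => change (tle H a b)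
  | _ => idtac
  end.

Ltac fold_rel_in p :=
  match type of p with
  | prv _ ?H (FEq ?a ?b) => change (teq H a b) in p
  | prv _ ?H (FLe ?a ?b) => change (tle H a b) in p
  | _ => idtac
  end.

(* Moves every hypothesis derived from [H] along [HK : incl H K] or
   [HK : incl (map fwk H) K]. *)
Ltac carry HK :=
  unfold teq, tle in *;
  repeat match goal with
  | p : prv _ _ _ |- _ =>
      first [apply (prv_weaken HK) in p | apply (prv_lift HK) in p]
  end;
  clear HK; simpl_subst;
  repeat match goal with
  | p : prv _ _ _ |- _ => progress (simpl_subst_in p; fold_rel_in p)
  end;
  fold_rel.

Tactic Notation "note" ident(p) ":=" uconstr(t) :=
  pose proof t as p; simpl_subst_in p; fold_rel_in p.

Tactic Notation "assume" ident(K) :=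
  let HK := fresh "HK" in intros K HK; carry HK.
Tactic Notation "assume" ident(K) ident(p) :=
  let HK := fresh "HK" in intros K HK p; carry HK.
Tactic Notation "assume" ident(K) ident(p) ident(q) :=
  let HK := fresh "HK" in intros K HK p q; carry HK.

Local Notation "a =[ H ] b" := (teq H a%tm b%tm)
  (at level 70, no associativity).
Local Notation "a <=[ H ] b" := (tle H a%tm b%tm)
  (at level 70, no associativity).

(** * Equality and beta-conversion *)

Hypothesis Ax_EPA : forall G (A : fm G), EPA_ax A -> Ax A.

Lemma prv_EPA G (H : list (fm G)) A : EPA_ax A -> H |-- A.
Proof. intros a; now apply prv_ax, Ax_EPA. Qed.

Lemma prv_leibniz G (H : list (fm G)) s (t u : tm G s) A : internal A ->
  t =[H] u -> H |-- fsubst (inst t) A -> H |-- fsubst (inst u) A.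
Proof.
  intros i tu p; eapply prv_impE; [eapply prv_impE |]; [| exact tu | exact p].
  now apply prv_EPA, ax_leibniz.
Qed.

Lemma teq_EPA G (H : list (fm G)) t (a b : tm G t) :
  EPA_ax (a == b) -> a =[H] b.
Proof. apply prv_EPA. Qed.

Lemma teq_refl G (H : list (fm G)) t (a : tm G t) : a =[H] a.
Proof. apply teq_EPA, ax_refl. Qed.

Lemma teq_leibniz G (H : list (fm G)) s t (a b : tm G s) (u v : tm (s :: G) t) :
  a =[H] b -> tsubst (inst a) u =[H] tsubst (inst a) v ->
  tsubst (inst b) u =[H] tsubst (inst b) v.
Proof. exact (@prv_leibniz G H s a b (u == v) I). Qed.

#[local] Instance teq_equiv G (H : list (fm G)) t :
  Equivalence (@teq G H t).
Proof.
  split.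
  - exact (@teq_refl G H t).
  - intros a b ab; note p := (teq_leibniz v0 (twk a) ab).
    exact (p (teq_refl H a)).
  - intros a b c ab bc; note p := (teq_leibniz (twk a) v0 bc); exact (p ab).
Qed.

#[local] Instance TApp_teq G (H : list (fm G)) s t :
  Proper (@teq G H _ ==> @teq G H _ ==> @teq G H _)%signature (@TApp G s t).
Proof.
  intros f g fg a b ab; transitivity (g @ a).
  - note p := (teq_leibniz (twk f @ twk a) (v0 @ twk a) fg).
    exact (p (teq_refl H _)).
  - note p := (teq_leibniz (twk g @ twk a) (twk g @ v0) ab).
    exact (p (teq_refl H _)).
Qed.

Lemma tpi_eq G (H : list (fm G)) s t (a : tm G s) (b : tm G t) :
  tpi s t @ a @ b =[H] a.
Proof. apply teq_EPA, ax_pi. Qed.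

Lemma tsigma_eq G (H : list (fm G)) r s t (x : tm G (r ==> s ==> t)) y z :
  tsigma r s t @ x @ y @ z =[H] x @ z @ (y @ z).
Proof. apply teq_EPA, ax_sigma. Qed.

(* [lam] does not commute with substitution ([lam (twk a)] is not [tpi _ _ @ a]
   when [a] is an application), so the substitution has to be part of the
   rule. *)
Lemma beta_subst G D (H : list (fm D)) (f : sub G D) s t (u : tm (s :: G) t) a :
  tsubst f (lam u) @ a =[H] tsubst (scons (P := tm D) a f) u.
Proof.
  induction u as [t x | t c | t1 t2 u1 IH1 u2 IH2]; cbn [lam tsubst].
  - pattern t, x; apply var_cons_ind; intros; cbn.
    + change (tsigma s (s ==> s) s @ tpi s (s ==> s) @ tpi s s @ a =[H] a).
      now rewrite tsigma_eq, tpi_eq.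
    + apply tpi_eq.
  - apply tpi_eq.
  - change (tsigma s t1 t2 @ tsubst f (lam u1) @ tsubst f (lam u2) @ a =[H]
      tsubst (scons (P := tm D) a f) u1 @ tsubst (scons (P := tm D) a f) u2).
    now rewrite tsigma_eq, IH1, IH2.
Qed.

Lemma beta G (H : list (fm G)) s t (u : tm (s :: G) t) a :
  lam u @ a =[H] tsubst (inst a) u.
Proof. rewrite <- (tsubst_id (lam u)); apply beta_subst. Qed.

(** * Arithmetic *)

#[local] Instance tsucc_teq G (H : list (fm G)) :
  Proper (@teq G H _ ==> @teq G H _)%signature (@tsucc G).
Proof. intros a b ab; unfold tsucc; now rewrite ab. Qed.

#[local] Instance tplus_teq G (H : list (fm G)) :
  Proper (@teq G H _ ==> @teq G H _ ==> @teq G H _)%signature (@tplus G).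
Proof. intros a b ab c d cd; unfold tplus, trec; now rewrite ab, cd. Qed.

Lemma prv_ind G (H : list (fm G)) A : internal A ->
  H |-- fsubst (inst tzero) A ->
  (forall K, incl (map (@fwk G Nat) H) K -> K |-- A ->
     K |-- fsubst inst_succ A) ->
  forall n, H |-- fsubst (inst n) A.
Proof.
  intros i zero succ n; apply prv_allE.
  eapply prv_impE; [eapply prv_impE |];
    [apply prv_EPA, ax_ind, i | exact zero |].
  apply prv_all_intro; intros K HK; apply prv_imp_intro; intros L KL.
  apply succ; exact (incl_tran HK KL).
Qed.

Tactic Notation "induct" uconstr(A) "on" constr(n) :=
  let p := fresh in
  unfold teq, tle;
  match goal with |- prv _ ?H _ => pose proof (@prv_ind _ H A) as p end;
  specialize (fun i zero succ => p i zero succ n);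
  simpl_subst_in p; apply p; clear p; [now cbn | fold_rel |].

Lemma tplus_0_r G (H : list (fm G)) a : tplus a tzero =[H] a.
Proof. apply teq_EPA, ax_rec0. Qed.

Lemma tplus_succ_r G (H : list (fm G)) a b :
  tplus a (tsucc b) =[H] tsucc (tplus a b).
Proof.
  unfold tplus at 1; transitivity (lam (lam (tsucc v1)) @ tplus a b @ b).
  - apply teq_EPA, ax_recS.
  - rewrite beta, beta_subst; reflexivity.
Qed.

Lemma tplus_0_l G (H : list (fm G)) a : tplus tzero a =[H] a.
Proof.
  induct (tplus tzero v0 == v0) on a.
  - apply tplus_0_r.
  - assume K IH; now rewrite tplus_succ_r, IH.
Qed.

Lemma tplus_succ_l G (H : list (fm G)) a b :
  tplus (tsucc a) b =[H] tsucc (tplus a b).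
Proof.
  induct (tplus (tsucc (twk a)) v0 == tsucc (tplus (twk a) v0)) on b.
  - now rewrite !tplus_0_r.
  - assume K IH; now rewrite !tplus_succ_r, IH.
Qed.

Lemma tplus_comm G (H : list (fm G)) a b : tplus a b =[H] tplus b a.
Proof.
  induct (tplus (twk a) v0 == tplus v0 (twk a)) on b.
  - now rewrite tplus_0_l, tplus_0_r.
  - assume K IH; now rewrite tplus_succ_l, tplus_succ_r, IH.
Qed.

Lemma tplus_assoc G (H : list (fm G)) a b c :
  tplus a (tplus b c) =[H] tplus (tplus a b) c.
Proof.
  induct (tplus (twk a) (tplus (twk b) v0) ==
          tplus (tplus (twk a) (twk b)) v0) on c.
  - now rewrite !tplus_0_r.
  - assume K IH; now rewrite !tplus_succ_r, IH.
Qed.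

Lemma tsucc_inj G (H : list (fm G)) a b : tsucc a =[H] tsucc b -> a =[H] b.
Proof. intros ab; eapply prv_impE; [apply prv_EPA, ax_succ_inj | exact ab]. Qed.

Lemma tsucc_eq_zero_absurd G (H : list (fm G)) a {C} :
  tsucc a =[H] tzero -> H |-- C.
Proof. intros a0; refine (prv_absurd _ a0); apply prv_EPA, ax_succ_neq0. Qed.

Lemma prv_nat_cases G (H : list (fm G)) n :
  H |-- n == tzero \./ FEx Nat (twk n == tsucc v0).
Proof.
  induct (v0 == tzero \./ FEx Nat (twk v0 == tsucc v0)) on n.
  - apply prv_orI1, prv_EPA, ax_refl.
  - intros K _ _; apply prv_orI2, prv_exI with v0; simpl_subst.
    apply teq_refl.
Qed.

Lemma prv_nat_elim G (H : list (fm G)) n {C} :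
  (forall K, incl H K -> n =[K] tzero -> K |-- C) ->
  (forall K, incl (map (@fwk G Nat) H) K -> twk n =[K] tsucc v0 ->
     K |-- fwk C) ->
  H |-- C.
Proof.
  intros zero succ; apply (prv_or_elim (prv_nat_cases H n)); [exact zero |].
  intros K HK p; apply (prv_ex_elim p); intros L KL e.
  apply succ; [exact (incl_tran (incl_map _ HK) KL) | exact e].
Qed.

(** * The ordering of the natural numbers *)

#[local] Instance tle_teq G (H : list (fm G)) :
  Proper (@teq G H _ ==> @teq G H _ ==> iff)%signature (@tle G H).
Proof.
  assert (le_eq : forall a b c d,
    a =[H] b -> c =[H] d -> a <=[H] c -> b <=[H] d).
  { intros a b c d ab cd ac.
    note bc := (@prv_leibniz _ H _ a b (FLe v0 (twk c)) I ab).
    note bd := (@prv_leibniz _ H _ c d (FLe (twk b) v0) I cd).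
    exact (bd (bc ac)). }
  intros a b ab c d cd; split; apply le_eq; assumption || now symmetry.
Qed.

Lemma tle_tplus_r G (H : list (fm G)) k d : k <=[H] tplus k d.
Proof. apply prv_exI with d; simpl_subst; apply teq_refl. Qed.

Lemma tle_tplus_l G (H : list (fm G)) k d : k <=[H] tplus d k.
Proof. rewrite tplus_comm; apply tle_tplus_r. Qed.

Lemma tle_succ G (H : list (fm G)) n : n <=[H] tsucc n.
Proof.
  rewrite <- (tplus_0_r H n) at 2; rewrite <- tplus_succ_r; apply tle_tplus_r.
Qed.

Lemma tle_elim G (H : list (fm G)) k n {C} : k <=[H] n ->
  (forall K, incl (map (@fwk G Nat) H) K ->
     twk n =[K] tplus (twk k) v0 -> K |-- fwk C) -> H |-- C.
Proof. intros kn c; exact (prv_ex_elim kn c). Qed.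

#[local] Instance tle_preorder G (H : list (fm G)) : PreOrder (@tle G H).
Proof.
  split.
  - intros n; rewrite <- (tplus_0_r H n) at 2; apply tle_tplus_r.
  - intros k m n km mn; apply (tle_elim km); assume K km'.
    apply (tle_elim mn); assume L mn'; fold_rel.
    rewrite mn', km', <- tplus_assoc; apply tle_tplus_r.
Qed.

Lemma tle_0 G (H : list (fm G)) k : k <=[H] tzero -> k =[H] tzero.
Proof.
  intros le; apply (tle_elim le); assume K k0.
  apply (prv_nat_elim (n := v0)); assume L d_eq.
  - now rewrite k0, d_eq, tplus_0_r.
  - apply (@tsucc_eq_zero_absurd _ L (tplus (twk (twk k)) v0)).
    now rewrite k0, d_eq, tplus_succ_r.
Qed.

Lemma tle_succ_cases G (H : list (fm G)) k n :
  k <=[H] tsucc n -> H |-- k == tsucc n \./ FLe k n.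
Proof.
  intros le; apply (tle_elim le); assume K kn.
  apply (prv_nat_elim (n := v0)); assume L d_eq.
  - apply prv_orI1; fold_rel; now rewrite kn, d_eq, tplus_0_r.
  - apply prv_orI2; fold_rel.
    rewrite d_eq, tplus_succ_r in kn; apply tsucc_inj in kn.
    rewrite kn; apply tle_tplus_r.
Qed.

Lemma tle_total G (H : list (fm G)) k n : H |-- FLe k n \./ FLe n k.
Proof.
  induct (FLe (twk k) v0 \./ FLe v0 (twk k)) on n.
  - apply prv_orI2; fold_rel; rewrite <- (tplus_0_l H k); apply tle_tplus_r.
  - assume K IH; apply (prv_or_elim IH); assume L le.
    + apply prv_orI1; fold_rel; rewrite le; apply tle_succ.
    + apply (tle_elim le); assume M kn.
      apply (prv_nat_elim (n := v0)); assume N d_eq.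
      * apply prv_orI1; fold_rel; rewrite kn, d_eq, tplus_0_r; apply tle_succ.
      * apply prv_orI2; fold_rel.
        rewrite kn, d_eq, tplus_succ_r, <- tplus_succ_l; apply tle_tplus_r.
Qed.

(** * Bounding the entries of a finite sequence *)

Definition tsum_step : tm [] (Seq Nat ==> Nat ==> Nat ==> Nat) :=
  lam (lam (lam (tplus v1 (tnth v2 v0)))).

Definition tsum_below {G} (x : tm G (Seq Nat)) (n : tm G Nat) : tm G Nat :=
  trec n tzero (tclosed tsum_step @ x).

Lemma tsubst_tsum_below G D (f : sub G D) x n :
  tsubst f (tsum_below x n) = tsum_below (tsubst f x) (tsubst f n).
Proof. unfold tsum_below, trec; simpl_subst; reflexivity. Qed.

Hint Rewrite tsubst_tsum_below : subst.

Definition tsum : tm [] (Seq Nat ==> Nat) := lam (tsum_below v0 (tlen v0)).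

#[local] Instance tsum_below_teq G (H : list (fm G)) x :
  Proper (@teq G H _ ==> @teq G H _)%signature (tsum_below x).
Proof. intros a b ab; unfold tsum_below, trec; now rewrite ab. Qed.

Lemma tsum_below_succ G (H : list (fm G)) x n :
  tsum_below x (tsucc n) =[H] tplus (tsum_below x n) (tnth x n).
Proof.
  unfold tsum_below at 1.
  transitivity (tclosed tsum_step @ x @ tsum_below x n @ n).
  - apply teq_EPA, ax_recS.
  - unfold tclosed, tsum_step; rewrite !beta_subst; simpl_subst; reflexivity.
Qed.

Lemma tle_tnth_tsum_below G (H : list (fm G)) x i d :
  tnth x i <=[H] tsum_below x (tplus i (tsucc d)).
Proof.
  induct (FLe (tnth (twk x) (twk i))
    (tsum_below (twk x) (tplus (twk i) (tsucc v0)))) on d.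
  - rewrite tplus_succ_r, tplus_0_r, tsum_below_succ; apply tle_tplus_l.
  - assume K IH; rewrite IH, (tplus_succ_r K _ (tsucc _)), tsum_below_succ.
    apply tle_tplus_r.
Qed.

Lemma FIn_tle_tsum G (H : list (fm G)) k x :
  H |-- FIn k x -> k <=[H] tclosed tsum @ x.
Proof.
  intros kx; unfold tclosed, tsum; rewrite beta_subst; simpl_subst.
  apply (prv_ex_elim kx); assume K p.
  apply (prv_ex_elim (prv_andE1 p)); assume L i_lt_len.
  apply prv_andE2 in p; fold_rel_in p.
  rewrite p, <- i_lt_len; apply tle_tnth_tsum_below.
Qed.

(** * Standard and infinite numbers *)

Hypothesis Ax_P : forall G (A : fm G), P_ax A -> Ax A.

Lemma fsubst_FAllSt G D (f : sub G D) s A :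
  fsubst f (FAllSt (s := s) A) = FAllSt (fsubst (up f) A).
Proof. reflexivity. Qed.

Hint Rewrite fsubst_FAllSt : subst.

Lemma prv_allSt_intro G (H : list (fm G)) s A :
  (forall K, incl (map (@fwk G s) H) K -> K |-- FSt v0 -> K |-- A) ->
  H |-- FAllSt A.
Proof.
  intros p; apply prv_all_intro; intros K HK; apply prv_imp_intro; intros L KL.
  apply p; exact (incl_tran HK KL).
Qed.

Lemma prv_allSt_elim G (H : list (fm G)) s A (t : tm G s) :
  H |-- FAllSt A -> H |-- FSt t -> H |-- fsubst (inst t) A.
Proof. intros p; exact (prv_impE (prv_allE t p)). Qed.

Lemma prv_allInf_intro G (H : list (fm G)) A :
  (forall K, incl (map (@fwk G Nat) H) K -> K |-- FInf v0 -> K |-- A) ->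
  H |-- FAllInf A.
Proof.
  intros p; apply prv_all_intro; intros K HK; apply prv_imp_intro; intros L KL.
  apply p; exact (incl_tran HK KL).
Qed.

Lemma prv_allInf_elim G (H : list (fm G)) A n :
  H |-- FAllInf A -> H |-- FInf n -> H |-- fsubst (inst n) A.
Proof. intros p; exact (prv_impE (prv_allE n p)). Qed.

Lemma prv_exSt_intro G (H : list (fm G)) s A (t : tm G s) :
  H |-- FSt t -> H |-- fsubst (inst t) A -> H |-- FExSt A.
Proof. intros st p; apply prv_exI with t; exact (prv_andI st p). Qed.

Lemma prv_exSt_elim G (H : list (fm G)) s A {C} : H |-- FExSt A ->
  (forall K, incl (map (@fwk G s) H) K -> K |-- FSt v0 -> K |-- A ->
     K |-- fwk C) ->
  H |-- C.
Proof.
  intros p c; apply (prv_ex_elim p); intros K HK q.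
  exact (c K HK (prv_andE1 q) (prv_andE2 q)).
Qed.

Lemma prv_st_teq G (H : list (fm G)) t (a b : tm G t) :
  a =[H] b -> H |-- FSt a -> H |-- FSt b.
Proof.
  intros ab st; eapply prv_impE; [apply prv_ax, Ax_P, ax_st_eq |].
  exact (prv_andI st ab).
Qed.

Lemma prv_st_tclosed G (H : list (fm G)) t (u : tm [] t) :
  H |-- FSt (tclosed u).
Proof. apply prv_ax, Ax_P, ax_st_closed. Qed.

Lemma prv_st_app G (H : list (fm G)) s t (f : tm G (s ==> t)) a :
  H |-- FSt f -> H |-- FSt a -> H |-- FSt (f @ a).
Proof.
  intros stf sta; eapply prv_impE; [apply prv_ax, Ax_P, ax_st_app |].
  exact (prv_andI stf sta).
Qed.

Lemma prv_st_zero G (H : list (fm G)) : H |-- FSt tzero.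
Proof. exact (prv_st_tclosed H tzero). Qed.

Lemma prv_st_succ G (H : list (fm G)) n : H |-- FSt n -> H |-- FSt (tsucc n).
Proof. apply prv_st_app; exact (prv_st_tclosed H (TConst CSucc)). Qed.

Lemma prv_ext_ind G (H : list (fm G)) A :
  H |-- fsubst (inst tzero) A ->
  (forall K, incl (map (@fwk G Nat) H) K -> K |-- FSt v0 -> K |-- A ->
     K |-- fsubst inst_succ A) ->
  H |-- FAllSt A.
Proof.
  intros zero succ; eapply prv_impE; [apply prv_ax, Ax_P, ax_ext_ind |].
  apply prv_andI; [exact zero |].
  apply prv_allSt_intro; intros K HK st; apply prv_imp_intro; intros L KL.
  apply succ; [exact (incl_tran HK KL) | exact (prv_weaken KL st)].
Qed.

Lemma prv_HAC G (H : list (fm G)) r t (A : fm (t :: r :: G)) : internal A ->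
  H |-- FAllSt (FExSt A) ->
  H |-- FExSt (s := r ==> Seq t) (FAllSt (s := r) (FEx t
          (FIn v0 (v2 @ v1) /.\ fsubst (up (up shift)) A))).
Proof.
  intros i p; eapply prv_impE; [now apply prv_ax, Ax_P, ax_HAC | exact p].
Qed.

Lemma prv_st_tle G (H : list (fm G)) k n :
  k <=[H] n -> H |-- FSt n -> H |-- FSt k.
Proof.
  intros kn st.
  assert (st_closed : H |-- FAllSt (FAll Nat (FLe v0 v1 -.> FSt v0))).
  { apply prv_ext_ind; simpl_subst.
    - apply prv_all_intro; assume K; apply prv_imp_intro; assume L k0.
      apply prv_st_teq with tzero;
        [symmetry; apply tle_0, k0 | apply prv_st_zero].
    - assume K stn IH; apply prv_all_intro; assume L.
      apply prv_imp_intro; assume M le.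
      apply (prv_or_elim (tle_succ_cases le)); assume N le'.
      + apply prv_st_teq with (tsucc v1);
          [now symmetry | now apply prv_st_succ].
      + note st_v0 := (prv_allE v0 IH); exact (prv_impE st_v0 le'). }
  note st_k := (prv_allE k (prv_allSt_elim st_closed st)).
  exact (prv_impE st_k kn).
Qed.

Lemma prv_inf_tle G (H : list (fm G)) k n :
  k <=[H] n -> H |-- FInf k -> H |-- FInf n.
Proof.
  intros kn inf; apply prv_imp_intro; assume K st.
  exact (prv_absurd inf (prv_st_tle kn st)).
Qed.

Lemma tle_st_inf G (H : list (fm G)) k n :
  H |-- FSt k -> H |-- FInf n -> k <=[H] n.
Proof.
  intros st inf.
  apply (prv_or_elim (tle_total H k n)); assume K le; [exact le |].
  exact (prv_absurd inf (prv_st_tle le st)).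
Qed.

Lemma prv_st_of_internal G (H : list (fm G)) B : internal B ->
  H |-- FAllSt B -> H |-- FAll Nat (B -.> FSt v0) ->
  forall n : tm G Nat, H |-- FSt n.
Proof.
  intros i st_B B_st n; refine (prv_impE (prv_allE n B_st) _).
  apply prv_ind; [exact i | now apply prv_allSt_elim, prv_st_zero |].
  assume K b.
  note b_st := (prv_allE v0 B_st); apply prv_impE with (2 := b) in b_st.
  note b_succ := (prv_allSt_elim st_B (prv_st_succ b_st)); exact b_succ.
Qed.

(* If no standard number satisfies [A], then [~ A] defines the standard
   numbers. *)
Lemma prv_underspill G (H : list (fm G)) A m : internal A ->
  H |-- FInf m -> H |-- FAllInf A -> H |-- FExSt A.
Proof.
  intros i inf all; apply prv_by_contradiction; assume K none.
  apply (prv_absurd inf).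
  apply prv_st_of_internal with (\neg A)%fm; [now split | |].
  - apply prv_allSt_intro; assume L st; apply prv_imp_intro; assume M a.
    apply (prv_impE none), prv_exSt_intro with v0; [exact st |].
    simpl_subst; exact a.
  - apply prv_all_intro; assume L; apply prv_imp_intro; assume M not_a.
    apply prv_by_contradiction; assume N inf'.
    apply (prv_impE not_a).
    note a := (prv_allInf_elim all inf'); exact a.
Qed.

(** * Functions that are constant on the infinite numbers *)

Definition FConstantFrom {G t} (g : tm G (Nat ==> t)) (k : tm G Nat) : fm G :=
  FAll Nat (FLe (twk k) v0 -.> twk g @ v0 == twk g @ twk k).

Lemma fsubst_FConstantFrom G D (f : sub G D) t (g : tm G (Nat ==> t)) k :
  fsubst f (FConstantFrom g k) = FConstantFrom (tsubst f g) (tsubst f k).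
Proof. unfold FConstantFrom; simpl_subst; reflexivity. Qed.

Hint Rewrite fsubst_FConstantFrom : subst.

Lemma FConstantFrom_teq G (H : list (fm G)) t (g : tm G (Nat ==> t)) k n :
  H |-- FConstantFrom g k -> k <=[H] n -> g @ n =[H] g @ k.
Proof.
  intros p kn; note p_n := (prv_allE n p); exact (prv_impE p_n kn).
Qed.

Lemma FConstantFrom_of_inf G (H : list (fm G)) t (g : tm G (Nat ==> t)) M :
  H |-- FInf M -> H |-- FAllInf (twk g @ twk M == twk g @ v0) ->
  H |-- FExSt (FConstantFrom (twk g) v0).
Proof.
  intros inf const; apply prv_underspill with M; [now split | exact inf |].
  apply prv_allInf_intro; assume K N_inf.
  apply prv_all_intro; assume L; apply prv_imp_intro; assume E N_le_n.
  note at_n := (prv_allInf_elim const (prv_inf_tle N_le_n N_inf)).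
  note at_N := (prv_allInf_elim const N_inf).
  now rewrite <- at_n, <- at_N.
Qed.

Definition FModulusIn {G s t} (F : tm G (s ==> Nat ==> t))
  (f : tm G (s ==> Seq Nat)) : fm G :=
  FAllSt (s := s) (FEx Nat (FIn v0 (twk (twk f) @ v1) /.\
    FConstantFrom (twk (twk F) @ v1) v0)).

Lemma fsubst_FModulusIn G D (h : sub G D) s t (F : tm G (s ==> Nat ==> t)) f :
  fsubst h (FModulusIn F f) = FModulusIn (tsubst h F) (tsubst h f).
Proof. unfold FModulusIn; simpl_subst; reflexivity. Qed.

Hint Rewrite fsubst_FModulusIn : subst.

Lemma FModulusIn_choice G (H : list (fm G)) s t
  (F : tm G (s ==> Nat ==> t)) {C} :
  H |-- FAllSt (FExSt (FConstantFrom (twk (twk F) @ v1) v0)) ->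
  (forall K, incl (map (@fwk G (s ==> Seq Nat)) H) K ->
     K |-- FSt v0 -> K |-- FModulusIn (twk F) v0 -> K |-- fwk C) ->
  H |-- C.
Proof.
  intros p c; apply prv_HAC in p; [| now split].
  apply (prv_exSt_elim p); intros K HK st mod.
  apply (c K HK st); simpl_subst_in mod.
  unfold FModulusIn; simpl_subst; exact mod.
Qed.

Definition tlimit s t :
  tm [] ((s ==> Nat ==> t) ==> (s ==> Seq Nat) ==> s ==> t) :=
  lam (lam (lam (v2 @ v0 @ (tclosed tsum @ (v1 @ v0))))).

Lemma tlimit_eq G (H : list (fm G)) s t (F : tm G (s ==> Nat ==> t)) f x :
  tclosed (tlimit s t) @ F @ f @ x =[H] F @ x @ (tclosed tsum @ (f @ x)).
Proof.
  unfold tclosed at 1, tlimit; rewrite !beta_subst; simpl_subst; reflexivity.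
Qed.

Lemma tlimit_inf G (H : list (fm G)) s t (F : tm G (s ==> Nat ==> t)) f x n :
  H |-- FSt f -> H |-- FModulusIn F f -> H |-- FSt x -> H |-- FInf n ->
  tclosed (tlimit s t) @ F @ f @ x =[H] F @ x @ n.
Proof.
  intros stf mod stx inf.
  assert (sum_le_n : tclosed tsum @ (f @ x) <=[H] n).
  { apply tle_st_inf; [| exact inf].
    apply prv_st_app; [apply prv_st_tclosed | now apply prv_st_app]. }
  rewrite tlimit_eq; note has_modulus := (prv_allSt_elim mod stx).
  apply (prv_ex_elim has_modulus); assume K p.
  note k_le_sum := (FIn_tle_tsum (prv_andE1 p)).
  apply prv_andE2 in p as const.
  rewrite (FConstantFrom_teq const k_le_sum); symmetry.
  apply (FConstantFrom_teq const); now rewrite k_le_sum.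
Qed.

Lemma Omega_invariant_constant G (H : list (fm G)) s
  (F : tm G (s ==> Nat ==> Nat)) M :
  H |-- FInf M -> H |-- Omega_invariant F M ->
  H |-- FAllSt (FExSt (FConstantFrom (twk (twk F) @ v1) v0)).
Proof.
  intros inf inv; unfold Omega_invariant in inv.
  apply prv_allSt_intro; assume K st.
  apply (FConstantFrom_of_inf (twk F @ v0) inf).
  note inv_x := (prv_allSt_elim inv st); exact inv_x.
Qed.

Lemma Omega_comprehension G (H : list (fm G)) s
  (F : tm G (s ==> Nat ==> Nat)) M :
  H |-- FSt F -> H |-- FInf M -> H |-- Omega_invariant F M ->
  H |-- FExSt (FAllSt (FAllInf (v2 @ v1 == twk (twk (twk F)) @ v1 @ v0))).
Proof.
  intros stF inf inv.
  apply (FModulusIn_choice F (Omega_invariant_constant inf inv)).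
  assume K stf mod.
  apply prv_exSt_intro with (tclosed (tlimit s Nat) @ twk F @ v0).
  { repeat first [assumption | apply prv_st_tclosed | apply prv_st_app]. }
  simpl_subst; apply prv_allSt_intro; assume L stx.
  apply prv_allInf_intro; assume M' inf'.
  now apply tlimit_inf.
Qed.

Lemma prv_Omega_CA s : [] |-- Omega_CA s.
Proof.
  apply prv_allSt_intro; assume K stF.
  apply prv_allInf_intro; assume L inf.
  apply prv_imp_intro; assume M inv.
  exact (Omega_comprehension stF inf inv).
Qed.

End Theory.

Theorem theorem3p7 (s : ty) : P_proves (Omega_CA s).
Proof.
  apply prv_Omega_CA.
  - exact P_ax_fsubst.
  - exact (@ax_EPA).
  - auto.
Qed.
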